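(* Consider the vector bundle (open disc bundle) $G\times_H\mathbb{R}^{d_1+1}$ over $G/H$ associated to one of the group diagrams (i) $G=Sp(2)$, $H=Sp(1)\times Sp(1)$, $K=U(1)\times Sp(1)$ (so $d_1=2$, $d_2=4$), or (ii) $G=Sp(1)\times Sp(2)$, $H=Sp(1)\times Sp(1)\times Sp(1)$, $K=Sp(1)\times Sp(1)$ (so $d_1=3$, $d_2=4$). Then the trajectories of the complete Ricci flat two summands metrics $dt^2+f_1(t)^2g_S+f_2(t)^2g_Q$ on these bundles are line segments when represented in the $(X_1,Y_1)$-coordinate plane, where $$X_1=\frac{1}{\mathrm{tr}(L)}\frac{\dot f_1}{f_1},\qquad Y_1=\frac{1}{\mathrm{tr}(L)}\frac{1}{f_1},\qquad \mathrm{tr}(L)=d_1\frac{\dot f_1}{f_1}+d_2\frac{\dot f_2}{f_2}.$$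
   Context: Here $K\subset H\subset G$ are closed subgroups of a compact Lie group with $H/K=S^{d_1}$; $H$ acts linearly on $\mathbb{R}^{d_1+1}$, and $G\times_H\mathbb{R}^{d_1+1}$ is a cohomogeneity one $G$-manifold with principal orbit $G/K$ and singular orbit $Q=G/H$ of dimension $d_2$. The isotropy representation of $G/K$ splits into two inequivalent irreducible summands $\mathfrak p_1$ (tangent to $H/K$) and $\mathfrak p_2$ (tangent to $Q$). Fix a bi-invariant metric $b$ on $G$ inducing the metric of constant curvature $1$ on $H/K$, and put $g_S=b|_{\mathfrak p_1}$, $g_Q=b|_{\mathfrak p_2}$. A two summands metric is a $G$-invariant metric which has the form $dt^2+f_1(t)^2g_S+f_2(t)^2g_Q$ for $t>0$, away from the singular orbit at $t=0$, and extends smoothly over it; this means $f_1(0)=0$, $\dot f_1(0)=1$, $f_2(0)>0$, $\dot f_2(0)=0$ for solutions of the Einstein equations. With $n=d_1+d_2$, the Ricci flat equations for such metrics are $\frac{d}{dt}\frac{\dot f_i}{f_i}=-\mathrm{tr}(L)\frac{\dot f_i}{f_i}+r_i$ ($i=1,2$) together with $\mathrm{tr}(\dot L)+\mathrm{tr}(L^2)=0$, where $L=\left(\frac{\dot f_1}{f_1}\mathbb{I}_{d_1},\frac{\dot f_2}{f_2}\mathbb{I}_{d_2}\right)$ and $$r_1=\frac{A_1}{d_1}\frac1{f_1^2}+\frac{A_3}{d_1}\frac{f_1^2}{f_2^4},\qquad r_2=\frac{A_2}{d_2}\frac1{f_2^2}-\frac{2A_3}{d_2}\frac{f_1^2}{f_2^4}.$$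 Here $A_1=d_1(d_1-1)$, $A_2=d_2\mathrm{Ric}^Q$, $A_3=d_2\|A\|^2$, with $\mathrm{Ric}^Q=12$, $\|A\|^2=8$ in case (i) and $\mathrm{Ric}^Q=12$, $\|A\|^2=3$ in case (ii). The trajectory of the metric in the $(X_1,Y_1)$-plane is the curve $t\mapsto(X_1(t),Y_1(t))$, $t>0$; on Ricci flat trajectories it determines the remaining quantities $\frac{1}{\mathrm{tr}(L)}\frac{\dot f_2}{f_2}$ and $\frac{1}{\mathrm{tr}(L)}\frac{1}{f_2}$ (the former through $\mathrm{tr}(L)=d_1\frac{\dot f_1}{f_1}+d_2\frac{\dot f_2}{f_2}$). *)

(* Defs.v *)
From Stdlib Require Import Reals.
From Coquelicot Require Import Coquelicot.
Open Scope R_scope.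

(** The group diagrams K < H < G:
    [Sp2]     : G = Sp(2),         H = Sp(1) x Sp(1),         K = U(1) x Sp(1);
    [Sp1xSp2] : G = Sp(1) x Sp(2), H = Sp(1) x Sp(1) x Sp(1), K = Sp(1) x Sp(1).
    They enter the equations through d1 = dim H/K, d2 = dim G/H, and the
    constants Ric^Q and ||A||^2 (values with respect to the bi-invariant metric
    normalised to have constant curvature 1 on H/K). *)
Inductive diagram : Set := Sp2 | Sp1xSp2.

Definition d1 (D : diagram) : nat :=
  match D with Sp2 => 2%nat | Sp1xSp2 => 3%nat end.
Definition d2 (D : diagram) : nat :=
  match D with Sp2 => 4%nat | Sp1xSp2 => 4%nat end.
Definition RicQ (D : diagram) : R :=
  match D with Sp2 => 12 | Sp1xSp2 => 12 end.
Definition normA2 (D : diagram) : R :=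
  match D with Sp2 => 8 | Sp1xSp2 => 3 end.

Definition A1 (D : diagram) : R := INR (d1 D) * (INR (d1 D) - 1).
Definition A2 (D : diagram) : R := INR (d2 D) * RicQ D.
Definition A3 (D : diagram) : R := INR (d2 D) * normA2 D.

(** The parameter t is the distance to the singular orbit, so the orbit space of
    the open disc bundle is [0, T) with T in (0, +oo]. *)
Definition in_dom (T : Rbar) (t : R) : Prop := 0 < t /\ Rbar_lt t T.

Definition smooth_on (T : Rbar) (f : R -> R) : Prop :=
  forall (k : nat) (t : R), in_dom T t -> ex_derive_n f k t.

(** dt^2 + f1^2 g_S + f2^2 g_Q on the part 0 < t < T of the bundle.  The last
    four fields read f1(0) = 0, f1'(0) = 1, f2(0) > 0, f2'(0) = 0, the values at
    the singular orbit being limits from the right, so that the values of f1 and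
    f2 outside (0, T) are irrelevant. *)
Record two_summands_metric (T : Rbar) (f1 f2 : R -> R) : Prop := {
  tsm_T_pos : Rbar_lt 0 T;
  tsm_smooth1 : smooth_on T f1;
  tsm_smooth2 : smooth_on T f2;
  tsm_pos1 : forall t, in_dom T t -> 0 < f1 t;
  tsm_pos2 : forall t, in_dom T t -> 0 < f2 t;
  tsm_f1_0 : filterlim f1 (at_right 0) (locally 0);
  tsm_df1_0 : filterlim (Derive f1) (at_right 0) (locally 1);
  tsm_f2_0 : exists a : R, 0 < a /\ filterlim f2 (at_right 0) (locally a);
  tsm_df2_0 : filterlim (Derive f2) (at_right 0) (locally 0)
}.

(** The orbits are compact and the curves t |-> (t, x) are unit speed geodesics
    normal to the orbits, so the metric is complete exactly when these exist for
    all t > 0. *)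
Definition complete_metric (T : Rbar) : Prop := T = p_infty.

Definition logder (f : R -> R) (t : R) : R := Derive f t / f t.

(** Traces of L, of its t-derivative and of L^2, where L is diagonal with entry
    f1'/f1 repeated d1 times and f2'/f2 repeated d2 times. *)
Definition trL (D : diagram) (f1 f2 : R -> R) (t : R) : R :=
  INR (d1 D) * logder f1 t + INR (d2 D) * logder f2 t.
Definition trdL (D : diagram) (f1 f2 : R -> R) (t : R) : R :=
  INR (d1 D) * Derive (logder f1) t + INR (d2 D) * Derive (logder f2) t.
Definition trL2 (D : diagram) (f1 f2 : R -> R) (t : R) : R :=
  INR (d1 D) * logder f1 t ^ 2 + INR (d2 D) * logder f2 t ^ 2.

Definition r1 (D : diagram) (f1 f2 : R -> R) (t : R) : R :=
  A1 D / INR (d1 D) * (1 / f1 t ^ 2)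
  + A3 D / INR (d1 D) * (f1 t ^ 2 / f2 t ^ 4).
Definition r2 (D : diagram) (f1 f2 : R -> R) (t : R) : R :=
  A2 D / INR (d2 D) * (1 / f2 t ^ 2)
  - 2 * A3 D / INR (d2 D) * (f1 t ^ 2 / f2 t ^ 4).

Definition ricci_flat (D : diagram) (T : Rbar) (f1 f2 : R -> R) : Prop :=
  forall t : R, in_dom T t ->
    Derive (logder f1) t = - trL D f1 f2 t * logder f1 t + r1 D f1 f2 t /\
    Derive (logder f2) t = - trL D f1 f2 t * logder f2 t + r2 D f1 f2 t /\
    trdL D f1 f2 t + trL2 D f1 f2 t = 0.

Definition X1 (D : diagram) (f1 f2 : R -> R) (t : R) : R :=
  1 / trL D f1 f2 t * logder f1 t.
Definition Y1 (D : diagram) (f1 f2 : R -> R) (t : R) : R :=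
  1 / trL D f1 f2 t * (1 / f1 t).

Definition trajectory (D : diagram) (T : Rbar) (f1 f2 : R -> R) : R * R -> Prop :=
  fun p => exists t : R, in_dom T t /\ p = (X1 D f1 f2 t, Y1 D f1 f2 t).

Definition seg_point (P Q : R * R) (s : R) : R * R :=
  ((1 - s) * fst P + s * fst Q, (1 - s) * snd P + s * snd Q).

(** A nondegenerate bounded segment; either endpoint may or may not belong to it. *)
Definition is_line_segment (S : R * R -> Prop) : Prop :=
  exists P Q : R * R, P <> Q /\
    (forall s : R, 0 < s < 1 -> S (seg_point P Q s)) /\
    (forall p : R * R, S p -> exists s : R, 0 <= s <= 1 /\ p = seg_point P Q s).

(* Main.v *)
Require Import Defs.
From Stdlib Require Import Reals Ranalysis5 Psatz.
From Coquelicot Require Import Coquelicot.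
(* [Reals] also has projections named [d1] and [d2]. *)
Import Defs.
Open Scope R_scope.

(** With [ds = dt / f1], the quantities [phi = f1'], [psi = f1 f2' / f2] and
    [v = f1^2 / f2^2] satisfy an autonomous polynomial system.  The Bryant-Salamon
    ansatz [phi = 1 - e v], [psi = c v] cuts out an invariant curve of it, and the
    defects [x = phi - 1 + e v], [y = psi - c v] satisfy a homogeneous linear
    system whose coefficient matrix at the singular orbit is negative definite for
    [x^2 + 16 y^2].  As the defects tend to 0 at the singular orbit, they vanish.
    On the invariant curve [X1 = 2 Y1 - 1 / d1] with [Y1 = 1 / (d1 (1 + e v))],
    and [v] increases from 0 to [1 / (e + c)]. *)

(** * The invariant curve and the distance from it *)

(* The only [c], [e] for which the curve [phi = 1 - e v], [psi = c v] is invariant. *)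
Definition coef_c (D : diagram) : R := match D with Sp2 => 4 | Sp1xSp2 => 3 end.
Definition coef_e (D : diagram) : R := match D with Sp2 => 4 | Sp1xSp2 => 2 end.

(** This is [f1'] wherever [f1] is nonzero, written through [logder] because the Ricci flat
    equations prescribe the derivative of [logder]. *)
Definition phi (f1 : R -> R) (t : R) : R := f1 t * logder f1 t.
Definition psi (f1 f2 : R -> R) (t : R) : R := f1 t * logder f2 t.
Definition ratio (f1 f2 : R -> R) (t : R) : R := f1 t ^ 2 / f2 t ^ 2.

Definition defect1 (D : diagram) (f1 f2 : R -> R) (t : R) : R :=
  phi f1 t - 1 + coef_e D * ratio f1 f2 t.
Definition defect2 (D : diagram) (f1 f2 : R -> R) (t : R) : R :=
  psi f1 f2 t - coef_c D * ratio f1 f2 t.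
(** At the singular orbit the linear system has the rows [(2 - 2 d1, -4)] and [(0, 1 - d1)]. With
    equal weights the resulting quadratic form is indefinite for [d1 = 2]; the weight 16 on the
    second defect absorbs the entry [-4]. *)
Definition defect_energy (D : diagram) (f1 f2 : R -> R) (t : R) : R :=
  defect1 D f1 f2 t ^ 2 + 16 * defect2 D f1 f2 t ^ 2.

(* [auto_derive] leaves eta-expanded derivatives, on which [is_derive_unique] does
   not rewrite. *)
Lemma derive_eta_unique (f : R -> R) (t l : R) :
  is_derive f t l -> Derive (fun s : R => f s) t = l.
Proof. exact (is_derive_unique f t l). Qed.

(** * Monotonicity and comparison lemmas on the line *)

Lemma derive_nonpos_le (g dg : R -> R) (a b : R) :
  a <= b ->
  (forall t, a <= t <= b -> is_derive g t (dg t)) ->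
  (forall t, a <= t <= b -> dg t <= 0) ->
  g b <= g a.
Proof.
  intros Hab Hd Hneg.
  destruct (MVT_gen g a b dg) as [m [Hm Heq]].
  - intros t Ht; rewrite Rmin_left, Rmax_right in Ht by lra.
    apply Hd; lra.
  - intros t Ht; rewrite Rmin_left, Rmax_right in Ht by lra.
    apply continuity_pt_filterlim, (ex_derive_continuous g).
    exists (dg t); apply Hd; lra.
  - rewrite Rmin_left, Rmax_right in Hm by lra.
    specialize (Hneg m Hm); nra.
Qed.

Lemma derive_nonneg_le (g dg : R -> R) (a b : R) :
  a <= b ->
  (forall t, a <= t <= b -> is_derive g t (dg t)) ->
  (forall t, a <= t <= b -> 0 <= dg t) ->
  g a <= g b.
Proof.
  intros Hab Hd Hpos.
  assert (H : - g b <= - g a); [| lra].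
  apply (derive_nonpos_le (fun t => - g t) (fun t => - dg t)); [exact Hab | |].
  - intros t Ht; apply (is_derive_opp g t (dg t)), Hd, Ht.
  - intros t Ht; specialize (Hpos t Ht); lra.
Qed.

Lemma derive_zero_eq (g : R -> R) (a b : R) :
  a <= b ->
  (forall t, a <= t <= b -> is_derive g t 0) ->
  g b = g a.
Proof.
  intros Hab Hd; apply Rle_antisym.
  - apply (derive_nonpos_le g (fun _ => 0)); auto; intros; lra.
  - apply (derive_nonneg_le g (fun _ => 0)); auto; intros; lra.
Qed.

Lemma at_right_lim_near (f : R -> R) (l eps : R) :
  filterlim f (at_right 0) (locally l) -> 0 < eps ->
  exists d, 0 < d /\ forall t, 0 < t < d -> Rabs (f t - l) < eps.
Proof.
  intros Hf He.
  destruct (proj1 (filterlim_locally f l) Hf (mkposreal eps He)) as [d Hd].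
  exists d; split; [apply cond_pos |].
  intros t Ht; apply (Hd t); [| lra].
  unfold ball; simpl; unfold AbsRing_ball, abs, minus, plus, opp; simpl.
  rewrite Rabs_pos_eq; lra.
Qed.

(** Only a limit is available at 0, so the mean value argument starts at some [u > 0]: a positive
    [g t] would exceed [g u] for [u] small enough. *)
Lemma nonincreasing_from_zero (g dg : R -> R) (d : R) :
  filterlim g (at_right 0) (locally 0) ->
  (forall t, 0 < t < d -> is_derive g t (dg t)) ->
  (forall t, 0 < t < d -> dg t <= 0) ->
  forall t, 0 < t < d -> g t <= 0.
Proof.
  intros Hlim Hd Hneg t Ht.
  apply Rnot_lt_le; intros Hpos.
  destruct (at_right_lim_near g 0 (g t) Hlim Hpos) as [d' [Hd' Hnear]].
  set (u := Rmin t (d' / 2)).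
  assert (Hu : 0 < u) by (apply Rmin_pos; lra).
  assert (u <= t) by apply Rmin_l.
  assert (u <= d' / 2) by apply Rmin_r.
  assert (Habs := Hnear u ltac:(lra)).
  apply Rabs_def2 in Habs.
  assert (g t <= g u); [| lra].
  apply (derive_nonpos_le g dg); [lra | |]; intros s Hs; [apply Hd | apply Hneg]; lra.
Qed.

(** The differential inequality makes [g t * exp (- C * t)] nonincreasing. *)
Lemma gronwall_zero (g dg : R -> R) (C a b : R) :
  a <= b ->
  (forall t, a <= t <= b -> is_derive g t (dg t)) ->
  (forall t, a <= t <= b -> dg t <= C * g t) ->
  g a <= 0 -> g b <= 0.
Proof.
  intros Hab Hd Hle Ha.
  assert (H : g b * exp (- C * b) <= g a * exp (- C * a)).
  { apply (derive_nonpos_le (fun t => g t * exp (- C * t))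
             (fun t => (dg t - C * g t) * exp (- C * t))); [exact Hab | |].
    - intros t Ht; specialize (Hd t Ht).
      auto_derive; [exists (dg t); exact Hd |].
      rewrite (derive_eta_unique _ _ _ Hd); ring.
    - intros t Ht; specialize (Hle t Ht); pose proof (exp_pos (- C * t)); nra. }
  pose proof (exp_pos (- C * a)); pose proof (exp_pos (- C * b)); nra.
Qed.


(** * Derivatives of the metric functions and the polynomial system *)

Lemma smooth_is_derive (f : R -> R) (t : R) :
  smooth_on p_infty f -> 0 < t -> is_derive f t (Derive f t).
Proof.
  (* For [T = p_infty] the upper bound in [in_dom] reduces to [True], whence the proof term [I]. *)
  intros Hf Ht; apply Derive_correct; exact (Hf 1%nat t (conj Ht I)).
Qed.

Lemma smooth_derive_is_derive (f : R -> R) (t : R) :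
  smooth_on p_infty f -> 0 < t -> is_derive (Derive f) t (Derive (Derive f) t).
Proof.
  intros Hf Ht; apply Derive_correct; exact (Hf 2%nat t (conj Ht I)).
Qed.

Lemma is_derive_logder (f : R -> R) (t : R) :
  smooth_on p_infty f -> 0 < t -> f t <> 0 ->
  is_derive (logder f) t (Derive (logder f) t).
Proof.
  intros Hf Ht Hne; apply Derive_correct.
  exists ((Derive (Derive f) t * f t - Derive f t * Derive f t) / f t ^ 2).
  apply is_derive_div; [now apply smooth_derive_is_derive | now apply smooth_is_derive | exact Hne].
Qed.

Lemma is_derive_of_logder (f : R -> R) (t : R) :
  smooth_on p_infty f -> 0 < t -> f t <> 0 -> is_derive f t (f t * logder f t).
Proof.
  intros Hf Ht Hne; replace (f t * logder f t) with (Derive f t).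
  - now apply smooth_is_derive.
  - unfold logder; field; exact Hne.
Qed.

(** Here and in the next two lemmas the factor [1 / f1 t] stays in front: it is the change of
    parameter [ds = dt / f1], and what follows it is a polynomial in [phi], [psi] and [ratio]. *)
Lemma is_derive_ratio (f1 f2 : R -> R) (t : R) :
  two_summands_metric p_infty f1 f2 -> 0 < t ->
  is_derive (ratio f1 f2) t
    (1 / f1 t * (2 * ratio f1 f2 t * (phi f1 t - psi f1 f2 t))).
Proof.
  intros [_ S1 S2 P1 P2 _ _ _ _] Ht.
  assert (H1 := P1 t (conj Ht I)); assert (H2 := P2 t (conj Ht I)).
  assert (D1 := is_derive_of_logder f1 t S1 Ht ltac:(lra)).
  assert (D2 := is_derive_of_logder f2 t S2 Ht ltac:(lra)).
  unfold ratio, phi, psi; auto_derive.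
  - repeat split; [eexists; exact D1 | eexists; exact D2 | nra].
  - rewrite (derive_eta_unique _ _ _ D1), (derive_eta_unique _ _ _ D2); field; lra.
Qed.

Lemma is_derive_phi (D : diagram) (f1 f2 : R -> R) (t : R) :
  two_summands_metric p_infty f1 f2 -> ricci_flat D p_infty f1 f2 -> 0 < t ->
  is_derive (phi f1) t
    (1 / f1 t *
       (phi f1 t ^ 2
        - (INR (d1 D) * phi f1 t + INR (d2 D) * psi f1 f2 t) * phi f1 t
        + A1 D / INR (d1 D) + A3 D / INR (d1 D) * ratio f1 f2 t ^ 2)).
Proof.
  intros [_ S1 S2 P1 P2 _ _ _ _] RF Ht.
  assert (H1 := P1 t (conj Ht I)); assert (H2 := P2 t (conj Ht I)).
  assert (D1 := is_derive_of_logder f1 t S1 Ht ltac:(lra)).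
  assert (DL := is_derive_logder f1 t S1 Ht ltac:(lra)).
  destruct (RF t (conj Ht I)) as [E1 _].
  unfold phi; auto_derive.
  - split; [eexists; exact D1 | split; [eexists; exact DL | exact I]].
  - rewrite (derive_eta_unique _ _ _ D1), (derive_eta_unique _ _ _ DL), E1.
    unfold trL, r1, psi, ratio; field.
    destruct D; simpl; repeat split; lra.
Qed.

Lemma is_derive_psi (D : diagram) (f1 f2 : R -> R) (t : R) :
  two_summands_metric p_infty f1 f2 -> ricci_flat D p_infty f1 f2 -> 0 < t ->
  is_derive (psi f1 f2) t
    (1 / f1 t *
       (phi f1 t * psi f1 f2 t
        - (INR (d1 D) * phi f1 t + INR (d2 D) * psi f1 f2 t) * psi f1 f2 t
        + A2 D / INR (d2 D) * ratio f1 f2 t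
        - 2 * A3 D / INR (d2 D) * ratio f1 f2 t ^ 2)).
Proof.
  intros [_ S1 S2 P1 P2 _ _ _ _] RF Ht.
  assert (H1 := P1 t (conj Ht I)); assert (H2 := P2 t (conj Ht I)).
  assert (D1 := is_derive_of_logder f1 t S1 Ht ltac:(lra)).
  assert (DL := is_derive_logder f2 t S2 Ht ltac:(lra)).
  destruct (RF t (conj Ht I)) as [_ [E2 _]].
  unfold psi; auto_derive.
  - split; [eexists; exact D1 | split; [eexists; exact DL | exact I]].
  - rewrite (derive_eta_unique _ _ _ D1), (derive_eta_unique _ _ _ DL), E2.
    unfold trL, r2, phi, ratio; field.
    destruct D; simpl; repeat split; lra.
Qed.

(* The entries of the linear system [f1 (x, y)' = ((lin11, lin12), (lin21, lin22)) (x, y)]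
   for the defects [x], [y], along a given solution. *)
Definition lin11 (D : diagram) (p v : R) : R :=
  1 + p + coef_e D * v - INR (d1 D) * (1 + p + coef_e D * v).
Definition lin12 (D : diagram) (p v : R) : R :=
  - INR (d2 D) * p - 2 * coef_e D * v.
Definition lin21 (D : diagram) (q v : R) : R :=
  - INR (d1 D) * q - coef_c D * v.
Definition lin22 (D : diagram) (p q v : R) : R :=
  p + 2 * coef_c D * v - INR (d1 D) * (1 + coef_e D * v) - INR (d2 D) * q.

Definition energy_rate (D : diagram) (f1 f2 : R -> R) (t : R) : R :=
  let x := defect1 D f1 f2 t in
  let y := defect2 D f1 f2 t in
  let p := phi f1 t in
  let q := psi f1 f2 t in
  let v := ratio f1 f2 t in
  2 / f1 t *
    (lin11 D p v * x ^ 2 + (lin12 D p v + 16 * lin21 D q v) * (x * y)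
     + 16 * lin22 D p q v * y ^ 2).

(** Invariance of the curve is what leaves a quadratic form in the defects, without terms of lower
    order. It depends on the numerical constants of each diagram, hence the case split before
    [field]. *)
Lemma is_derive_defect_energy (D : diagram) (f1 f2 : R -> R) (t : R) :
  two_summands_metric p_infty f1 f2 -> ricci_flat D p_infty f1 f2 -> 0 < t ->
  is_derive (defect_energy D f1 f2) t (energy_rate D f1 f2 t).
Proof.
  intros M RF Ht.
  assert (H1 := tsm_pos1 _ _ _ M t (conj Ht I)).
  assert (Dv := is_derive_ratio f1 f2 t M Ht).
  assert (Dp := is_derive_phi D f1 f2 t M RF Ht).
  assert (Dq := is_derive_psi D f1 f2 t M RF Ht).
  unfold defect_energy, defect1, defect2; auto_derive.
  - repeat split; eexists; eassumption.
  - rewrite (derive_eta_unique _ _ _ Dv), (derive_eta_unique _ _ _ Dp),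
      (derive_eta_unique _ _ _ Dq).
    unfold energy_rate, defect1, defect2, lin11, lin12, lin21, lin22, A1, A2, A3.
    destruct D; simpl; field; lra.
Qed.

(** Away from 0 the coefficients of the form are continuous and the energy is positive definite, so
    the form is at most a constant times the energy. This feeds [gronwall_zero]. *)
Lemma energy_rate_locally_bounded (D : diagram) (f1 f2 : R -> R) (a b : R) :
  two_summands_metric p_infty f1 f2 -> ricci_flat D p_infty f1 f2 ->
  0 < a <= b ->
  exists C, forall t, a <= t <= b ->
    energy_rate D f1 f2 t <= C * defect_energy D f1 f2 t.
Proof.
  intros M RF Hab.
  (* The bounds [r <= 1 + r ^ 2] and [q * (x * y) <= x ^ 2 + q ^ 2 * y ^ 2] replace absolute values,
     so that [m] stays differentiable. *)
  set (m := fun t =>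
    2 / f1 t *
      (3 + lin11 D (phi f1 t) (ratio f1 f2 t) ^ 2
       + (lin12 D (phi f1 t) (ratio f1 f2 t)
          + 16 * lin21 D (psi f1 f2 t) (ratio f1 f2 t)) ^ 2
       + lin22 D (phi f1 t) (psi f1 f2 t) (ratio f1 f2 t) ^ 2)).
  destruct (continuity_ab_maj m a b) as [u [Hu _]]; [lra | |].
  - intros t Ht; apply continuity_pt_filterlim, (ex_derive_continuous m).
    assert (Ht0 : 0 < t) by lra.
    assert (H1 := tsm_pos1 _ _ _ M t (conj Ht0 I)).
    assert (D1 := smooth_is_derive f1 t (tsm_smooth1 _ _ _ M) Ht0).
    assert (Dv := is_derive_ratio f1 f2 t M Ht0).
    assert (Dp := is_derive_phi D f1 f2 t M RF Ht0).
    assert (Dq := is_derive_psi D f1 f2 t M RF Ht0).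
    unfold m, lin11, lin12, lin21, lin22; auto_derive.
    repeat split; try (eexists; eassumption); lra.
  - exists (m u); intros t Ht.
    apply Rle_trans with (m t * defect_energy D f1 f2 t).
    + assert (H1 := tsm_pos1 _ _ _ M t (conj (Rlt_le_trans _ _ _ (proj1 Hab) (proj1 Ht)) I)).
      assert (Ha : 0 < 2 / f1 t) by (apply Rdiv_lt_0_compat; lra).
      unfold energy_rate, m, defect_energy.
      set (x := defect1 D f1 f2 t); set (y := defect2 D f1 f2 t).
      generalize (lin11 D (phi f1 t) (ratio f1 f2 t)),
        (lin12 D (phi f1 t) (ratio f1 f2 t)
         + 16 * lin21 D (psi f1 f2 t) (ratio f1 f2 t)),
        (lin22 D (phi f1 t) (psi f1 f2 t) (ratio f1 f2 t)).
      intros p q s; rewrite (Rmult_assoc (2 / f1 t) _ (x ^ 2 + 16 * y ^ 2)); apply Rmult_le_compat_l; [lra |].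
      assert (Hsq : forall r, r <= 1 + r ^ 2) by (clear; intros r; nra).
      assert (Hx : 0 <= x ^ 2) by apply pow2_ge_0.
      assert (Hy : 0 <= y ^ 2) by apply pow2_ge_0.
      assert (p * x ^ 2 <= (1 + p ^ 2) * x ^ 2) by now apply Rmult_le_compat_r.
      assert (s * y ^ 2 <= (1 + s ^ 2) * y ^ 2) by now apply Rmult_le_compat_r.
      assert (q * (x * y) <= x ^ 2 + q ^ 2 * y ^ 2) by (clear; nra).
      assert (Hpos : forall r z, 0 <= r ^ 2 * z ^ 2)
        by (intros; apply Rmult_le_pos; apply pow2_ge_0).
      pose proof (Hpos p y); pose proof (Hpos q x); pose proof (Hpos q y);
        pose proof (Hpos s x); pose proof (Hpos s y).
      lra.
    + apply Rmult_le_compat_r; [unfold defect_energy; clear; nra | auto].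
Qed.

(** * Limits at the singular orbit *)

Lemma at_right_lim_plus (f g : R -> R) (l m : R) :
  filterlim f (at_right 0) (locally l) -> filterlim g (at_right 0) (locally m) ->
  filterlim (fun t => f t + g t) (at_right 0) (locally (l + m)).
Proof.
  intros Hf Hg.
  exact (filterlim_comp_2 _ _ plus Hf Hg (filterlim_plus l m)).
Qed.

Lemma at_right_lim_mult (f g : R -> R) (l m : R) :
  filterlim f (at_right 0) (locally l) -> filterlim g (at_right 0) (locally m) ->
  filterlim (fun t => f t * g t) (at_right 0) (locally (l * m)).
Proof.
  intros Hf Hg.
  exact (filterlim_comp_2 _ _ mult Hf Hg (filterlim_mult l m)).
Qed.

Lemma at_right_lim_inv (f : R -> R) (l : R) :
  l <> 0 -> filterlim f (at_right 0) (locally l) ->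
  filterlim (fun t => / f t) (at_right 0) (locally (/ l)).
Proof.
  intros Hl Hf; apply (filterlim_comp _ _ _ f Rinv _ (locally l)); [exact Hf |].
  apply (ex_derive_continuous Rinv); auto_derive; exact Hl.
Qed.

Lemma at_right_lim_ext (f g : R -> R) (l : R) :
  (forall t, 0 < t -> f t = g t) ->
  filterlim f (at_right 0) (locally l) -> filterlim g (at_right 0) (locally l).
Proof.
  intros Hfg; apply filterlim_ext_loc.
  exists (mkposreal 1 Rlt_0_1); intros t _ Ht; exact (Hfg t Ht).
Qed.

Lemma phi_lim (f1 f2 : R -> R) :
  two_summands_metric p_infty f1 f2 -> filterlim (phi f1) (at_right 0) (locally 1).
Proof.
  intros M; apply (at_right_lim_ext (Derive f1)); [| apply (tsm_df1_0 _ _ _ M)].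
  intros t Ht; unfold phi, logder.
  assert (H1 := tsm_pos1 _ _ _ M t (conj Ht I)); field; lra.
Qed.

Lemma psi_lim (f1 f2 : R -> R) :
  two_summands_metric p_infty f1 f2 -> filterlim (psi f1 f2) (at_right 0) (locally 0).
Proof.
  intros M; destruct (tsm_f2_0 _ _ _ M) as [a [Ha Hf2]].
  replace (locally 0) with (locally (0 * (0 * / a))) by (f_equal; ring).
  apply at_right_lim_mult; [apply (tsm_f1_0 _ _ _ M) |].
  apply at_right_lim_mult; [apply (tsm_df2_0 _ _ _ M) |].
  apply at_right_lim_inv; [lra | exact Hf2].
Qed.

Lemma ratio_lim (f1 f2 : R -> R) :
  two_summands_metric p_infty f1 f2 -> filterlim (ratio f1 f2) (at_right 0) (locally 0).
Proof.
  intros M; destruct (tsm_f2_0 _ _ _ M) as [a [Ha Hf2]].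
  apply (at_right_lim_ext (fun t => (f1 t * / f2 t) * (f1 t * / f2 t))).
  - intros t Ht; assert (H2 := tsm_pos2 _ _ _ M t (conj Ht I)).
    unfold ratio; field; lra.
  - assert (H : filterlim (fun t => f1 t * / f2 t) (at_right 0) (locally (0 * / a))).
    { apply at_right_lim_mult; [apply (tsm_f1_0 _ _ _ M) |].
      apply at_right_lim_inv; [lra | exact Hf2]. }
    rewrite Rmult_0_l in H.
    replace (locally 0) with (locally (0 * 0)) by (f_equal; ring); now apply at_right_lim_mult.
Qed.

Lemma defect_energy_lim (D : diagram) (f1 f2 : R -> R) :
  two_summands_metric p_infty f1 f2 ->
  filterlim (defect_energy D f1 f2) (at_right 0) (locally 0).
Proof.
  intros M.
  assert (Hc : forall k : R, filterlim (fun _ : R => k) (at_right 0) (locally k))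
    by (intros; apply filterlim_const).
  assert (Hx : filterlim (defect1 D f1 f2) (at_right 0)
                 (locally (1 + - (1) + coef_e D * 0))).
  { apply at_right_lim_plus; [apply at_right_lim_plus |]; auto.
    - now apply (phi_lim f1 f2).
    - apply at_right_lim_mult; auto using ratio_lim. }
  assert (Hy : filterlim (fun t => psi f1 f2 t + - coef_c D * ratio f1 f2 t) (at_right 0)
                 (locally (0 + - coef_c D * 0))).
  { apply at_right_lim_plus; [now apply psi_lim |].
    apply at_right_lim_mult; auto using ratio_lim. }
  replace (1 + - (1) + coef_e D * 0) with 0 in Hx by ring.
  replace (0 + - coef_c D * 0) with 0 in Hy by ring.
  apply (at_right_lim_ext
    (fun t => defect1 D f1 f2 t * defect1 D f1 f2 t
      + 16 * ((psi f1 f2 t + - coef_c D * ratio f1 f2 t)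
              * (psi f1 f2 t + - coef_c D * ratio f1 f2 t)))).
  - intros t _; unfold defect_energy, defect2; ring.
  - replace (locally 0) with (locally (0 * 0 + 16 * (0 * 0))) by (f_equal; ring).
    apply at_right_lim_plus; [now apply at_right_lim_mult |].
    apply at_right_lim_mult; [apply Hc | now apply at_right_lim_mult].
Qed.

(** * Vanishing of the defects *)

(** The form is negative definite at the limit [(phi, psi, ratio) = (1, 0, 0)], hence also at nearby
    values; the singular factor [2 / f1 t] is positive and does not affect the sign. *)
Lemma energy_rate_nonpos_near_zero (D : diagram) (f1 f2 : R -> R) :
  two_summands_metric p_infty f1 f2 ->
  exists d, 0 < d /\ forall t, 0 < t < d -> energy_rate D f1 f2 t <= 0.
Proof.
  intros M.
  assert (He : 0 < 1 / 1000) by lra.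
  destruct (at_right_lim_near _ _ _ (phi_lim f1 f2 M) He) as [dp [Hdp Hp]].
  destruct (at_right_lim_near _ _ _ (psi_lim f1 f2 M) He) as [dq [Hdq Hq]].
  destruct (at_right_lim_near _ _ _ (ratio_lim f1 f2 M) He) as [dv [Hdv Hv]].
  exists (Rmin dp (Rmin dq dv)); split; [repeat apply Rmin_pos; assumption |].
  intros t Ht.
  assert (B1 := Rmin_l dp (Rmin dq dv)); assert (B2 := Rmin_r dp (Rmin dq dv)).
  assert (B3 := Rmin_l dq dv); assert (B4 := Rmin_r dq dv).
  assert (Hp' := Rabs_def2 _ _ (Hp t ltac:(lra))).
  assert (Hq' := Rabs_def2 _ _ (Hq t ltac:(lra))).
  assert (Hv' := Rabs_def2 _ _ (Hv t ltac:(lra))).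
  assert (H1 := tsm_pos1 _ _ _ M t (conj (proj1 Ht) I)).
  assert (Ha : 0 < 2 / f1 t) by (apply Rdiv_lt_0_compat; lra).
  unfold energy_rate; cbv zeta.
  set (x := defect1 D f1 f2 t); set (y := defect2 D f1 f2 t).
  (* The coefficients of [x ^ 2], [x * y] and [y ^ 2] are bounded by [-1], [5] in absolute value,
     and [-8]; definiteness survives since [5 ^ 2 < 4 * 1 * 8]. *)
  assert (C1 : lin11 D (phi f1 t) (ratio f1 f2 t) <= - 1)
    by (unfold lin11; destruct D; simpl; lra).
  assert (C2 : -5 <= lin12 D (phi f1 t) (ratio f1 f2 t)
                     + 16 * lin21 D (psi f1 f2 t) (ratio f1 f2 t) <= 5)
    by (unfold lin12, lin21; destruct D; simpl; lra).
  assert (C3 : lin22 D (phi f1 t) (psi f1 f2 t) (ratio f1 f2 t) <= - 1 / 2)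
    by (unfold lin22; destruct D; simpl; lra).
  revert C1 C2 C3.
  generalize (lin11 D (phi f1 t) (ratio f1 f2 t)),
    (lin12 D (phi f1 t) (ratio f1 f2 t)
     + 16 * lin21 D (psi f1 f2 t) (ratio f1 f2 t)),
    (lin22 D (phi f1 t) (psi f1 f2 t) (ratio f1 f2 t)).
  intros p q s C1 C2 C3.
  assert (0 <= x ^ 2) by apply pow2_ge_0.
  assert (0 <= y ^ 2) by apply pow2_ge_0.
  assert (p * x ^ 2 <= -1 * x ^ 2) by now apply Rmult_le_compat_r.
  assert (s * y ^ 2 <= -1 / 2 * y ^ 2) by now apply Rmult_le_compat_r.
  (* Expanding [(x - q * y / 2) ^ 2 >= 0] gives this, and [25 / 4] is below the available 8. *)
  assert (q * (x * y) <= x ^ 2 + 25 / 4 * y ^ 2).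
  { assert (q ^ 2 <= 25) by (clear - C2; nra).
    assert (q ^ 2 * y ^ 2 <= 25 * y ^ 2) by (apply Rmult_le_compat_r; auto using pow2_ge_0).
    pose proof (pow2_ge_0 (x - q * y / 2)).
    lra. }
  assert (HE : p * x ^ 2 + q * (x * y) + 16 * s * y ^ 2 <= 0) by lra.
  pose proof (Rmult_le_compat_l _ _ _ (Rlt_le _ _ Ha) HE); lra.
Qed.

(** The linear system blows up at 0 like [1 / f1], so Gronwall cannot start there. The sign of the
    energy rate settles a first interval, and Gronwall carries the vanishing on to any later [t]. *)
Lemma defects_vanish (D : diagram) (f1 f2 : R -> R) (t : R) :
  two_summands_metric p_infty f1 f2 -> ricci_flat D p_infty f1 f2 -> 0 < t ->
  phi f1 t = 1 - coef_e D * ratio f1 f2 t /\ psi f1 f2 t = coef_c D * ratio f1 f2 t.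
Proof.
  intros M RF Ht.
  destruct (energy_rate_nonpos_near_zero D f1 f2 M) as [d [Hd Hneg]].
  assert (Hnear : forall s, 0 < s < d -> defect_energy D f1 f2 s <= 0).
  { apply (nonincreasing_from_zero _ (energy_rate D f1 f2)).
    - now apply defect_energy_lim.
    - intros s Hs; apply is_derive_defect_energy; tauto.
    - exact Hneg. }
  assert (Hz : defect_energy D f1 f2 t <= 0).
  { set (a := Rmin t (d / 2)).
    assert (Ha : 0 < a) by (apply Rmin_pos; lra).
    assert (Hat : a <= t) by apply Rmin_l.
    assert (Had : a <= d / 2) by apply Rmin_r.
    destruct (energy_rate_locally_bounded D f1 f2 a t M RF (conj Ha Hat)) as [C HC].
    apply (gronwall_zero _ (energy_rate D f1 f2) C a t Hat).
    - intros s Hs; apply is_derive_defect_energy; auto; lra.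
    - exact HC.
    - apply Hnear; lra. }
  unfold defect_energy in Hz.
  assert (defect1 D f1 f2 t = 0) by (clear - Hz; nra).
  assert (defect2 D f1 f2 t = 0) by (clear - Hz; nra).
  unfold defect1, defect2 in *; lra.
Qed.

(** * The range of the ratio *)

(** On the invariant curve this is the positive value of the ratio at which [phi = psi], that is,
    the nonzero equilibrium of its equation. *)
Definition ratio_max (D : diagram) : R := / (coef_e D + coef_c D).

Definition ratio_gap (D : diagram) (f1 f2 : R -> R) (t : R) : R :=
  ratio_max D - ratio f1 f2 t.

Lemma ratio_max_pos (D : diagram) : 0 < ratio_max D.
Proof. apply Rinv_0_lt_compat; destruct D; simpl; lra. Qed.

Lemma ratio_pos (f1 f2 : R -> R) (t : R) :
  two_summands_metric p_infty f1 f2 -> 0 < t -> 0 < ratio f1 f2 t.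
Proof.
  intros M Ht; apply Rdiv_lt_0_compat; apply pow_lt.
  - exact (tsm_pos1 _ _ _ M t (conj Ht I)).
  - exact (tsm_pos2 _ _ _ M t (conj Ht I)).
Qed.

Lemma is_derive_f2 (D : diagram) (f1 f2 : R -> R) (t : R) :
  two_summands_metric p_infty f1 f2 -> ricci_flat D p_infty f1 f2 -> 0 < t ->
  is_derive f2 t (coef_c D * f1 t / f2 t).
Proof.
  intros M RF Ht.
  assert (H1 := tsm_pos1 _ _ _ M t (conj Ht I)).
  assert (H2 := tsm_pos2 _ _ _ M t (conj Ht I)).
  assert (D2 := is_derive_of_logder f2 t (tsm_smooth2 _ _ _ M) Ht ltac:(lra)).
  replace (coef_c D * f1 t / f2 t) with (f2 t * logder f2 t); [exact D2 |].
  assert (E : f2 t * logder f2 t = f2 t * psi f1 f2 t / f1 t)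
    by (unfold psi; field; lra).
  rewrite E, (proj2 (defects_vanish D f1 f2 t M RF Ht)).
  unfold ratio; field; lra.
Qed.

(** On the curve [phi - psi = (e + c) * gap], and [ratio / f1 = f1 / f2 ^ 2]. The gap thus solves a
    homogeneous linear equation and keeps its sign. *)
Lemma is_derive_ratio_gap (D : diagram) (f1 f2 : R -> R) (t : R) :
  two_summands_metric p_infty f1 f2 -> ricci_flat D p_infty f1 f2 -> 0 < t ->
  is_derive (ratio_gap D f1 f2) t
    (- 2 * (coef_e D + coef_c D) * f1 t / f2 t ^ 2 * ratio_gap D f1 f2 t).
Proof.
  intros M RF Ht.
  assert (H1 := tsm_pos1 _ _ _ M t (conj Ht I)).
  assert (H2 := tsm_pos2 _ _ _ M t (conj Ht I)).
  assert (Dv := is_derive_ratio f1 f2 t M Ht).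
  destruct (defects_vanish D f1 f2 t M RF Ht) as [Ep Eq].
  rewrite Ep, Eq in Dv.
  unfold ratio_gap; auto_derive; [eexists; exact Dv |].
  rewrite (derive_eta_unique _ _ _ Dv).
  unfold ratio_max, ratio; destruct D; simpl; field; lra.
Qed.

Lemma ratio_gap_pos (D : diagram) (f1 f2 : R -> R) (t : R) :
  two_summands_metric p_infty f1 f2 -> ricci_flat D p_infty f1 f2 -> 0 < t ->
  0 < ratio_gap D f1 f2 t.
Proof.
  intros M RF Ht.
  (* [gap * f2 ^ (2 (e + c) / c)] is constant, since [f2' / f2 = c f1 / f2^2]. *)
  set (h := fun s => ratio_gap D f1 f2 s
                     * exp (2 * (coef_e D + coef_c D) / coef_c D * ln (f2 s))).
  assert (Hh : forall s, 0 < s -> is_derive h s 0).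
  { intros s Hs; unfold h.
    assert (H2 := tsm_pos2 _ _ _ M s (conj Hs I)).
    assert (Dg := is_derive_ratio_gap D f1 f2 s M RF Hs).
    assert (D2 := is_derive_f2 D f1 f2 s M RF Hs).
    auto_derive; [split; [eexists; exact Dg | split; [eexists; exact D2 | tauto]] |].
    rewrite (derive_eta_unique _ _ _ Dg), (derive_eta_unique _ _ _ D2).
    destruct D; simpl; field; lra. }
  (* The constant is positive because the ratio is still below [ratio_max] near 0. *)
  destruct (at_right_lim_near _ _ _ (ratio_lim f1 f2 M) (ratio_max_pos D))
    as [d [Hd Hnear]].
  set (a := Rmin t (d / 2)).
  assert (Ha : 0 < a) by (apply Rmin_pos; lra).
  assert (Hat : a <= t) by apply Rmin_l.
  assert (Had : a <= d / 2) by apply Rmin_r.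
  assert (Hr := Rabs_def2 _ _ (Hnear a ltac:(lra))).
  assert (E : h t = h a) by (apply derive_zero_eq; [lra |]; intros; apply Hh; lra).
  assert (0 < h a) by (apply Rmult_lt_0_compat; [unfold ratio_gap; lra | apply exp_pos]).
  assert (Hpos : 0 < h t) by lra.
  unfold h in Hpos.
  apply (Rmult_lt_reg_r (exp (2 * (coef_e D + coef_c D) / coef_c D * ln (f2 t))));
    [apply exp_pos |].
  lra.
Qed.

(** The derivative is [1 - e * ratio], and the ratio stays below [1 / (e + c) < 1 / e]. *)
Lemma f1_increasing (D : diagram) (f1 f2 : R -> R) (s t : R) :
  two_summands_metric p_infty f1 f2 -> ricci_flat D p_infty f1 f2 -> 0 < s <= t ->
  f1 s <= f1 t.
Proof.
  intros M RF Hst.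
  apply (derive_nonneg_le f1 (fun u => f1 u * logder f1 u)); [lra | |]; intros u Hu;
    assert (Hu0 : 0 < u) by lra.
  - assert (H1 := tsm_pos1 _ _ _ M u (conj Hu0 I)).
    apply is_derive_of_logder; [apply (tsm_smooth1 _ _ _ M) | exact Hu0 | lra].
  - change (0 <= phi f1 u).
    rewrite (proj1 (defects_vanish D f1 f2 u M RF Hu0)).
    assert (Hlt := ratio_gap_pos D f1 f2 u M RF Hu0).
    unfold ratio_gap, ratio_max in Hlt; destruct D; simpl in *; lra.
Qed.

(** The derivative of [f2 ^ 2] is [2 * c * f1], and [f1] is at least [f1 1] from time 1 on. *)
Lemma f2_sq_growth (D : diagram) (f1 f2 : R -> R) (t : R) :
  two_summands_metric p_infty f1 f2 -> ricci_flat D p_infty f1 f2 -> 1 <= t ->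
  2 * coef_c D * f1 1 * (t - 1) <= f2 t ^ 2.
Proof.
  intros M RF Ht.
  assert (H : f2 1 ^ 2 - 2 * coef_c D * f1 1 * (1 - 1)
              <= f2 t ^ 2 - 2 * coef_c D * f1 1 * (t - 1)).
  { apply (derive_nonneg_le (fun s => f2 s ^ 2 - 2 * coef_c D * f1 1 * (s - 1))
             (fun s => 2 * coef_c D * (f1 s - f1 1))); [exact Ht | |]; intros s Hs.
    - assert (Hs0 : 0 < s) by lra.
      assert (H2 := tsm_pos2 _ _ _ M s (conj Hs0 I)).
      assert (D2 := is_derive_f2 D f1 f2 s M RF Hs0).
      auto_derive; [eexists; exact D2 |].
      rewrite (derive_eta_unique _ _ _ D2); field; lra.
    - assert (Hm := f1_increasing D f1 f2 1 s M RF ltac:(lra)).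
      destruct D; simpl; lra. }
  pose proof (pow2_ge_0 (f2 1)); lra.
Qed.

(** Differentiating the product, the decay [-2 * (e + c)] of the gap outweighs the growth [2 * c] of
    [f2 ^ 2]. With the growth of [f2 ^ 2], this forces the gap to 0. *)
Lemma ratio_gap_decay (D : diagram) (f1 f2 : R -> R) (t : R) :
  two_summands_metric p_infty f1 f2 -> ricci_flat D p_infty f1 f2 -> 1 <= t ->
  ratio_gap D f1 f2 t * f2 t ^ 2
    <= ratio_gap D f1 f2 1 * f2 1 ^ 2.
Proof.
  intros M RF Ht.
  apply (derive_nonpos_le (fun s => ratio_gap D f1 f2 s * f2 s ^ 2)
    (fun s => - 2 * coef_e D * f1 s * ratio_gap D f1 f2 s));
    [exact Ht | |]; intros s Hs; assert (Hs0 : 0 < s) by lra.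
  - assert (H2 := tsm_pos2 _ _ _ M s (conj Hs0 I)).
    assert (Dg := is_derive_ratio_gap D f1 f2 s M RF Hs0).
    assert (D2 := is_derive_f2 D f1 f2 s M RF Hs0).
    auto_derive; [split; [eexists; exact Dg | split; [eexists; exact D2 | exact I]] |].
    rewrite (derive_eta_unique _ _ _ Dg), (derive_eta_unique _ _ _ D2).
    destruct D; simpl; field; lra.
  - assert (H1 := tsm_pos1 _ _ _ M s (conj Hs0 I)).
    assert (Hlt := ratio_gap_pos D f1 f2 s M RF Hs0).
    assert (0 <= f1 s * ratio_gap D f1 f2 s) by (apply Rmult_le_pos; lra).
    destruct D; unfold coef_e; lra.
Qed.

(** Completeness enters here: the ratio comes close to [ratio_max] only for large [t]. The
    intermediate value theorem does the rest. *)
Lemma ratio_surj (D : diagram) (f1 f2 : R -> R) (v : R) :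
  two_summands_metric p_infty f1 f2 -> ricci_flat D p_infty f1 f2 ->
  0 < v < ratio_max D -> exists t, 0 < t /\ ratio f1 f2 t = v.
Proof.
  intros M RF Hv.
  assert (H1 := tsm_pos1 _ _ _ M 1 (conj Rlt_0_1 I)).
  assert (Hcc : 0 < coef_c D) by (destruct D; simpl; lra).
  assert (Hc : 0 < 2 * coef_c D * f1 1) by (destruct D; simpl; lra).
  assert (Hfar : exists b, 1 <= b /\ v < ratio f1 f2 b).
  { set (K := ratio_gap D f1 f2 1 * f2 1 ^ 2).
    assert (HK : 0 <= K).
    { apply Rmult_le_pos; [| apply pow2_ge_0].
      exact (Rlt_le _ _ (ratio_gap_pos D f1 f2 1 M RF Rlt_0_1)). }
    (* Chosen so that the lower bound for [f2 b ^ 2], times [ratio_max D - v], is [K + 1]. Were the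
       ratio at [b] at most [v], the product of gap and [f2 ^ 2] would exceed its bound [K]. *)
    set (b := 1 + (K + 1) / (2 * coef_c D * f1 1 * (ratio_max D - v))).
    assert (Hb : 1 <= b).
    { assert (0 <= (K + 1) / (2 * coef_c D * f1 1 * (ratio_max D - v))); [| unfold b; lra].
      apply Rlt_le, Rdiv_lt_0_compat; [lra | apply Rmult_lt_0_compat; lra]. }
    exists b; split; [exact Hb |].
    assert (Hg := f2_sq_growth D f1 f2 b M RF Hb).
    assert (Hd := ratio_gap_decay D f1 f2 b M RF Hb); fold K in Hd.
    assert (Eb : 2 * coef_c D * f1 1 * (b - 1) * (ratio_max D - v) = K + 1)
      by (unfold b; field; repeat split; lra).
    apply Rnot_le_lt; intros Hle.
    assert (K + 1 <= f2 b ^ 2 * (ratio_max D - v)).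
    { rewrite <- Eb; apply Rmult_le_compat_r; lra. }
    assert (f2 b ^ 2 * (ratio_max D - v) <= f2 b ^ 2 * ratio_gap D f1 f2 b)
      by (apply Rmult_le_compat_l; [apply pow2_ge_0 | unfold ratio_gap; lra]).
    lra. }
  destruct Hfar as [b [Hb Hvb]].
  destruct (at_right_lim_near _ _ _ (ratio_lim f1 f2 M) (proj1 Hv)) as [d [Hd Hnear]].
  (* The cap [1 / 2] keeps [a] below [b], which is at least 1. *)
  set (a := Rmin (1 / 2) (d / 2)).
  assert (Ha : 0 < a) by (apply Rmin_pos; lra).
  assert (Ha1 : a <= 1 / 2) by apply Rmin_l.
  assert (Had : a <= d / 2) by apply Rmin_r.
  assert (Hr := Rabs_def2 _ _ (Hnear a ltac:(lra))).
  destruct (IVT_interv (fun s => ratio f1 f2 s - v) a b) as [t [Ht Et]]; try lra.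
  - intros s Hs; apply continuity_pt_filterlim.
    apply (ex_derive_continuous (fun s => ratio f1 f2 s - v)).
    assert (Dv := is_derive_ratio f1 f2 s M ltac:(lra)).
    auto_derive; eexists; exact Dv.
  - exists t; lra.
Qed.

(** * The trajectory in the plane *)

Lemma X1_Y1_of_ratio (D : diagram) (f1 f2 : R -> R) (t : R) :
  two_summands_metric p_infty f1 f2 -> ricci_flat D p_infty f1 f2 -> 0 < t ->
  X1 D f1 f2 t = (1 - coef_e D * ratio f1 f2 t)
                 / (INR (d1 D) * (1 + coef_e D * ratio f1 f2 t)) /\
  Y1 D f1 f2 t = 1 / (INR (d1 D) * (1 + coef_e D * ratio f1 f2 t)).
Proof.
  intros M RF Ht.
  assert (H1 := tsm_pos1 _ _ _ M t (conj Ht I)).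
  assert (Hv := ratio_pos f1 f2 t M Ht).
  destruct (defects_vanish D f1 f2 t M RF Ht) as [Ep Eq].
  assert (E1 : logder f1 t = (1 - coef_e D * ratio f1 f2 t) / f1 t)
    by (rewrite <- Ep; unfold phi; field; lra).
  assert (E2 : logder f2 t = coef_c D * ratio f1 f2 t / f1 t)
    by (rewrite <- Eq; unfold psi; field; lra).
  (* For both diagrams [d2 * c = 2 * d1 * e], which turns [d1 * (1 - e v) + d2 * c v] into
     [d1 * (1 + e v)]. *)
  assert (E : trL D f1 f2 t
              = INR (d1 D) * (1 + coef_e D * ratio f1 f2 t) / f1 t).
  { unfold trL; rewrite E1, E2; destruct D; simpl; field; lra. }
  unfold X1, Y1; rewrite E, E1.
  split; destruct D; simpl; field; repeat split; lra.
Qed.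

(* The endpoints of the trajectory, at [v = 0] and [v = 1 / (e + c)]. *)
Definition vertex_start (D : diagram) : R * R :=
  match D with Sp2 => (1 / 2, 1 / 2) | Sp1xSp2 => (1 / 3, 1 / 3) end.
Definition vertex_end (D : diagram) : R * R :=
  match D with Sp2 => (1 / 6, 1 / 3) | Sp1xSp2 => (1 / 7, 5 / 21) end.

(** This is [(2 e + c) v / (1 + e v)], the fraction of the way that [Y1] has gone from its value at
    [v = 0] to its value at [v = 1 / (e + c)]. *)
Definition segment_param (D : diagram) (v : R) : R :=
  match D with Sp2 => 12 * v / (1 + 4 * v) | Sp1xSp2 => 7 * v / (1 + 2 * v) end.

Definition ratio_of_param (D : diagram) (s : R) : R :=
  match D with Sp2 => s / (12 - 4 * s) | Sp1xSp2 => s / (7 - 2 * s) end.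

Lemma segment_param_range (D : diagram) (v : R) :
  0 < v < ratio_max D -> 0 <= segment_param D v <= 1.
Proof.
  intros Hv; unfold ratio_max in Hv; destruct D; simpl in *;
    (split; [apply Rlt_le, Rdiv_lt_0_compat; lra | apply Rle_div_l; lra]).
Qed.

Lemma ratio_of_param_range (D : diagram) (s : R) :
  0 < s < 1 -> 0 < ratio_of_param D s < ratio_max D.
Proof.
  intros Hs; unfold ratio_max; destruct D; simpl;
    (split; [apply Rdiv_lt_0_compat; lra | apply Rlt_div_l; lra]).
Qed.

Lemma segment_param_of_ratio_of_param (D : diagram) (s : R) :
  0 < s < 1 -> segment_param D (ratio_of_param D s) = s.
Proof.
  intros Hs; destruct D; simpl; field; lra.
Qed.

Lemma trajectory_point (D : diagram) (f1 f2 : R -> R) (t : R) :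
  two_summands_metric p_infty f1 f2 -> ricci_flat D p_infty f1 f2 -> 0 < t ->
  (X1 D f1 f2 t, Y1 D f1 f2 t)
  = seg_point (vertex_start D) (vertex_end D) (segment_param D (ratio f1 f2 t)).
Proof.
  intros M RF Ht.
  assert (Hv := ratio_pos f1 f2 t M Ht).
  destruct (X1_Y1_of_ratio D f1 f2 t M RF Ht) as [EX EY].
  rewrite EX, EY; unfold seg_point; destruct D; simpl; f_equal; field; lra.
Qed.

Theorem theorem2p30 (D : diagram) (T : Rbar) (f1 f2 : R -> R) :
  two_summands_metric T f1 f2 ->
  complete_metric T ->
  ricci_flat D T f1 f2 ->
  is_line_segment (trajectory D T f1 f2).
Proof.
  intros M HT RF; unfold complete_metric in HT; subst T.
  (* Both endpoints are only limits of the trajectory, as the ratio stays strictly between 0 and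
     [ratio_max D]. *)
  exists (vertex_start D), (vertex_end D); split; [| split].
  - intros E; destruct D; simpl in E; injection E; lra.
  - intros s Hs.
    destruct (ratio_surj D f1 f2 _ M RF (ratio_of_param_range D s Hs)) as [t [Ht Et]].
    exists t; split; [exact (conj Ht I) |].
    rewrite (trajectory_point D f1 f2 t M RF Ht), Et,
      (segment_param_of_ratio_of_param D s Hs); reflexivity.
  - intros p [t [[Ht _] ->]].
    exists (segment_param D (ratio f1 f2 t)); split.
    + apply segment_param_range; split;
        [now apply (ratio_pos f1 f2) | now apply Rlt_0_minus, ratio_gap_pos].
    + now apply trajectory_point.
Qed.
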